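(* Let $\mathbf P$ be a partially ordered set, $D\subseteq P$ and $G:D\to P$ a function. Consider the following conditions on $G$: (ide) for all $a\in D$, if $Ga\in D$ then $GGa=Ga$; (inv) for all $a\in D$, if $Ga\in D$ then $GGa=a$; (invb) for all $a,b\in D$, if $Ga=Gb$ then $a=b$; (iso) for all $a,b\in D$, if $a\le b$ then $Ga\le Gb$; (isoide) for all $a,b\in D$, if $a\le Gb$ then $Ga\le Gb$; (isoide') for all $a,b\in D$, if $Ga\le b$ then $Ga\le Gb$; (ant) for all $a,b\in D$, if $a\le b$ then $Gb\le Ga$. Then the following hold. (A1e) $G$ can be extended to an extensive operation $K$ on $P$ if and only if $G$ is extensive. (A1c) $G$ can be extended to a contractive operation $K$ on $P$ if and only if $G$ is contractive. (A2) $G$ can be extended to an idempotent operation $K$ on $P$ if and only if $G$ satisfies (ide). (A2e) $G$ can be extended to an idempotent and extensive operation $K$ on $P$ if and only if $G$ satisfies (ide) and is extensive. (A2c) $G$ can be extended to an idempotent and contractive operation $K$ on $P$ if and only if $G$ satisfies (ide) and is contractive. (A3) $G$ can be extended to an involution $K$ on $P$ if and only if $G$ satisfies (inv) and (invb). Under the further assumption that $\mathbf P$ is a bounded complete lattice: (B1) $G$ can be extended to an isotone operation $K$ on $P$ if and only if $G$ satisfies (iso). (B1e) $G$ can be extended to an isotone and extensive operation $K$ on $P$ if and only if $G$ satisfies (iso) and is extensive. (B1c) $G$ can be extended to an isotone and contractive operation $K$ on $P$ if and only if $G$ satisfies (iso) and is contractive. (B2) $G$ can be extended to an isotone and idempotent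 operation $K$ on $P$ if and only if $G$ satisfies (iso), (isoide) and (isoide'). (B3) $G$ can be extended to a closure operation $K$ on $P$ if and only if $G$ satisfies (isoide) and is extensive. (B4) $G$ can be extended to an interior operation $K$ on $P$ if and only if $G$ satisfies (isoide') and is contractive. (B5) $G$ can be extended to an antitone operation $K$ on $P$ if and only if $G$ satisfies (ant). Suppose further (still with $\mathbf P$ a bounded complete lattice) that $n\in\mathbb N\setminus\{0\}$, $i,j\in\mathbb N$, $i+j\le n$, $X\subseteq P^n$ and $V:X\to P$ is a function. Then: (C1) $V$ can be extended to an $n$-ary operation $F$ on $P$ which is isotone on the first $i$ components and antitone on the last $j$ components if and only if the following condition (ison) holds: for all $n$-tuples $\bar a=(a_1,\dots,a_n)$, $\bar b=(b_1,\dots,b_n)\in X$, if $a_h\le b_h$ for every $h\le i$, $a_h=b_h$ for every $h$ with $i<h\le n-j$, and $a_h\ge b_h$ for every $h>n-j$, then $V\bar a\le V\bar b$. (C2) If $i\ge 1$, in (C1) one can additionally obtain $x_1\le F\bar x$ for all $\bar x\in P^n$, provided (ison) holds and $a_1\le V\bar a$ for all $\bar a\in X$. Similarly for any subset of the first $i$ variables (in place of the single variable $x_1$). (C3) More generally, given an $i$-ary lattice term $t$, in (C1) one can additionally obtain $t(x_1,\dots,x_i)\le F\bar x$ for all $\bar x\in P^n$, provided (ison) holds and $t(a_1,\dots,a_i)\le V\bar a$ for every $\bar a\in X$. In cases (B1)–(C3) the assumption that $\mathbf P$ is a bounded complete lattice can be weakened to ''every subset of the range of $G$ (respectively, of $V$)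 has a meet in $\mathbf P$'', except for cases (B1c) and (B4), in which the assumption can be weakened to ''every subset of the range of $G$ has a join in $\mathbf P$'', and except that in case (C3) one must further assume that $\mathbf P$ is a lattice.
   Context: A (total) unary operation $K:P\to P$ on a poset $\mathbf P$ is: extensive if $a\le Ka$ for all $a$; contractive if $Ka\le a$ for all $a$; isotone if $a\le b$ implies $Ka\le Kb$; antitone if $a\le b$ implies $Kb\le Ka$; idempotent if $KKa=Ka$ for all $a$; involutive (an involution) if $KKa=a$ for all $a$; a closure operation if it is extensive, isotone and idempotent; an interior operation if it is contractive, isotone and idempotent (no additivity or multiplicativity is assumed). A partial operation $G:D\to P$ is extensive (contractive) if $a\le Ga$ ($Ga\le a$) for all $a\in D$. An $n$-ary operation is isotone (antitone) on the $h$-th component if it is isotone (antitone) as a unary operation when the $h$-th argument varies and the other arguments are kept fixed. ''Complete'' is meant in the lattice-theoretical sense: every subset has a meet and a join. *)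

(* Defs.v *)
From mathcomp Require Import all_boot all_order.
From mathcomp Require Import all_classical.

Set Implicit Arguments.
Unset Strict Implicit.
Unset Printing Implicit Defensive.

Import Order.TTheory.
Local Open Scope classical_set_scope.
Local Open Scope order_scope.

(* A partial operation G : D -> P is a function on the subtype of the elements
   of D : set P; [SigSub h] is the element y of D given by h : y \in D. *)

Section Operations.
Context {d : Order.disp_t} {P : porderType d}.
Implicit Types K : P -> P.

Definition extensive K := forall a, a <= K a.
Definition contractive K := forall a, K a <= a.
Definition isotone K := {homo K : a b / a <= b}.
Definition antitone K := {homo K : a b /~ a <= b}.
Definition closure_op K := [/\ extensive K, isotone K & idempotent_fun K].
Definition interior_op K := [/\ contractive K, isotone K & idempotent_fun K].

End Operations.

Section PartialOperations.
Context {d : Order.disp_t} {P : porderType d} {D : set P}.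
Implicit Types (G : D -> P) (Q : (P -> P) -> Prop).

Definition pextensive G := forall a : D, val a <= G a.
Definition pcontractive G := forall a : D, G a <= val a.

Definition cond_ide G := forall (a : D) (h : G a \in D), G (SigSub h) = G a.
Definition cond_inv G := forall (a : D) (h : G a \in D), G (SigSub h) = val a.
Definition cond_invb G := forall a b : D, G a = G b -> a = b.
Definition cond_iso G := forall a b : D, val a <= val b -> G a <= G b.
Definition cond_isoide G := forall a b : D, val a <= G b -> G a <= G b.
Definition cond_isoide' G := forall a b : D, G a <= val b -> G a <= G b.
Definition cond_ant G := forall a b : D, val a <= val b -> G b <= G a.

Definition extendable G Q :=
  exists2 K : P -> P, (forall a : D, K (val a) = G a) & Q K.

End PartialOperations.

Section Completeness.
Context {d : Order.disp_t}.

(* Boundedness is the case S = set0. *)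
Definition complete_lattice (P : porderType d) :=
  forall S : set P, infimums S !=set0 /\ supremums S !=set0.

Definition has_meets {P : porderType d} (A : set P) :=
  forall S : set P, S `<=` A -> infimums S !=set0.
Definition has_joins {P : porderType d} (A : set P) :=
  forall S : set P, S `<=` A -> supremums S !=set0.

End Completeness.

(* P ^ n is {ffun 'I_n -> P}; components are numbered from 0, so the first i
   are the h < i and the last j are the h >= n - j. *)
Section NAryOperations.
Context {d : Order.disp_t} {P : porderType d} {n : nat}.
Implicit Types (F : P ^ n -> P) (h : 'I_n) (i j : nat).

Definition set_component (x : P ^ n) h (a : P) : P ^ n :=
  [ffun k => if k == h then a else x k].

Definition isotone_on F h :=
  forall x : P ^ n, isotone (fun a => F (set_component x h a)).
Definition antitone_on F h :=
  forall x : P ^ n, antitone (fun a => F (set_component x h a)).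

Definition iso_first_ant_last i j F :=
  (forall h, (h < i)%N -> isotone_on F h) /\
  (forall h, (n - j <= h)%N -> antitone_on F h).

Definition cond_ison i j (X : set (P ^ n)) (V : X -> P) :=
  forall a b : X,
    (forall h, (h < i)%N -> val a h <= val b h) ->
    (forall h, (i <= h < n - j)%N -> val a h = val b h) ->
    (forall h, (n - j <= h)%N -> val b h <= val a h) ->
    V a <= V b.

Definition nextendable (X : set (P ^ n)) (V : X -> P)
    (Q : (P ^ n -> P) -> Prop) :=
  exists2 F : P ^ n -> P, (forall a : X, F (val a) = V a) & Q F.

End NAryOperations.

Inductive lattice_term (i : nat) : Type :=
  | TVar of 'I_i
  | TMeet of lattice_term i & lattice_term i
  | TJoin of lattice_term i & lattice_term i.

Fixpoint eval_term {d : Order.disp_t} {L : latticeType d} {i : nat}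
    (t : lattice_term i) (x : 'I_i -> L) : L :=
  match t with
  | TVar h => x h
  | TMeet t1 t2 => eval_term t1 x `&` eval_term t2 x
  | TJoin t1 t2 => eval_term t1 x `|` eval_term t2 x
  end.

Definition first_components {T : Type} {n i j : nat} (hij : (i + j <= n)%N)
    (x : T ^ n) : 'I_i -> T :=
  fun h => x (widen_ord (leq_trans (leq_addr j i) hij) h).

(* Main.v *)
Require Import Defs.
From mathcomp Require Import all_boot all_order.
From mathcomp Require Import all_classical.
Import Order.TTheory.
Local Open Scope classical_set_scope.
Local Open Scope order_scope.

(** Each stated condition is inherited by restriction of an operation of the
    required kind, so the content lies in constructing extensions.

    Without completeness, extending [G] by the identity outside [D] already
    preserves idempotence, extensivity and contractivity.  For involutions one
    also has to send [G a] back to [a]: (inv) and (invb) say exactly that the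
    symmetric closure of the graph of [G] is functional, and a symmetric
    functional relation extends by the identity to an involution
    ([functional_symmetric_involution]).

    With meets, a map on a subset of a preordered set that is monotone extends
    to [x |-> inf {V a | x below a}] ([monotone_extension]).  This value is the
    greatest one allowed by the constraints that the points above [x] impose;
    hence every lower bound for [V] that is monotone in [x] is inherited by the
    extension.  Choosing the preorder covers isotone maps (the order), antitone
    maps (the reversed order) and the [n]-ary case (componentwise: the order on
    the first [i] components, equality in the middle, the reversed order on the
    last [j] ones).

    The formula above need not be idempotent, and neither is its variant with
    the constraints [z <= G a] for both [x <= a] and [x <= G a].  The remedy
    ([isotone_idempotent_extension]) is to take the greatest such [z] that
    moreover satisfies [z <= a -> z <= G a] for all [a] in [D], as every fixed
    point of an isotone extension must.  Such a [z] exists although the extra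
    condition is not a system of upper bounds, because it passes to the meet of
    the values of [G] lying above all candidates.  Closure operations are the
    extensive case.  The two statements on contractive isotone operations
    follow by reversing the order. *)

(** * Extensions on arbitrary posets *)

Section IdentityExtension.
Context {d : Order.disp_t} {P : porderType d} {D : set P}.
Implicit Type G : D -> P.

Definition id_extension G (x : P) : P := oapp G x (insub x).

Lemma id_extension_val G (a : D) : id_extension G (val a) = G a.
Proof. by rewrite /id_extension valK. Qed.

Lemma id_extension_out G (x : P) : x \notin D -> id_extension G x = x.
Proof. by move=> xD; rewrite /id_extension insubN. Qed.

Lemma id_extension_extensive G : pextensive G -> extensive (id_extension G).
Proof.
by move=> Ge x; rewrite /id_extension; case: insubP => [a _ <-|//]; exact: Ge.
Qed.

Lemma id_extension_contractive G :
  pcontractive G -> contractive (id_extension G).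
Proof.
by move=> Gc x; rewrite /id_extension; case: insubP => [a _ <-|//]; exact: Gc.
Qed.

Lemma id_extension_idempotent G :
  cond_ide G -> idempotent_fun (id_extension G).
Proof.
move=> Gi x /=; have [xD|xD] := boolP (x \in D); last first.
  by rewrite !(id_extension_out G x xD).
rewrite -[x]/(val (SigSub xD : D)) id_extension_val.
have [h|/id_extension_out//] := boolP (G (SigSub xD) \in D).
by rewrite -[X in id_extension G X]/(val (SigSub h : D)) id_extension_val Gi.
Qed.

End IdentityExtension.

(** The involution exchanges the two members of each related pair; symmetry
    makes the partner of the partner of [x] a candidate, functionality makes it
    the only one. *)
Lemma functional_symmetric_involution {T : choiceType} (R : T -> T -> Prop) :
    (forall x y, R x y -> R y x) ->
    (forall x y z, R x y -> R x z -> y = z) ->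
  exists2 K : T -> T, forall x y, R x y -> K x = y & involutive K.
Proof.
move=> Rsym Rfun; pose K x := xget x [set y | R x y].
have KE x y : R x y -> K x = y.
  by move=> Rxy; apply: xget_unique => // z Rxz; apply: Rfun Rxz Rxy.
exists K => // x; have [[y Rxy]|xN] := pselect (exists y, R x y).
  by rewrite (KE _ _ Rxy); apply/KE/Rsym.
have Kx : K x = x by rewrite /K xgetPN // => y Rxy; apply: xN; exists y.
by rewrite !Kx.
Qed.

Lemma involutive_extension {d : Order.disp_t} {P : porderType d} {D : set P}
    (G : D -> P) :
  cond_inv G -> cond_invb G -> extendable G (@involutive P).
Proof.
move=> Ginv Ginvb; pose graph x y := exists2 a : D, x = val a & y = G a.
have graph_inv x y z : graph x y -> graph z x -> y = z.
  move=> [a -> ->] [b -> aE].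
  have h : G b \in D by rewrite -aE; apply: valP.
  by rewrite -(Ginv b h); congr G; apply: val_inj.
have [||K KE Kinv] :=
    functional_symmetric_involution (fun x y => graph x y \/ graph y x).
- by move=> x y [|]; [right|left].
- move=> x y z [xy|yx] [xz|zx].
  + by case: xy xz => [a -> ->] [b /val_inj-> ->].
  + exact: graph_inv xy zx.
  + by apply/esym/(graph_inv x).
  + by case: yx zx => [a -> ->] [b -> /Ginvb->].
by exists K => // a; apply: KE; left; exists a.
Qed.

(** * Monotone extensions by meets *)

(** The last clause expresses that [F x] is the greatest possible value; it is
    the way in which lower bounds on [V] are passed on to [F]. *)
Lemma monotone_extension {T : Type} {d : Order.disp_t} {P : porderType d}
    (R : T -> T -> Prop) (X : set T) (V : X -> P) :
    (forall x, R x x) -> (forall x y z, R x y -> R y z -> R x z) ->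
    has_meets (range V) ->
    (forall a b : X, R (val a) (val b) -> V a <= V b) ->
  exists F : T -> P, [/\ forall a : X, F (val a) = V a,
    forall x y, R x y -> F x <= F y &
    forall x z, (forall a : X, R x (val a) -> z <= V a) -> z <= F x].
Proof.
move=> Rxx Rtrans meetV monoV.
have meet_above x : infimums [set V a | a in [set a : X | R x (val a)]] !=set0.
  by apply: meetV => _ [a _ <-]; exists a.
pose F x := projT1 (cid (meet_above x)).
have F_le x (a : X) : R x (val a) -> F x <= V a.
  by move=> xa; rewrite /F; case: cid => m /= [+ _]; apply; exists a.
have F_ge x z : (forall a : X, R x (val a) -> z <= V a) -> z <= F x.
  move=> zV; rewrite /F; case: cid => m /= [_]; apply.
  by move=> _ [a xa <-]; apply: zV.
exists F; split=> // [a|x y xy]; last first.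
  by apply: F_ge => a ya; exact: F_le (Rtrans _ _ _ xy ya).
by apply/le_anti/andP; split; [exact: F_le|apply: F_ge => b; exact: monoV].
Qed.

Section UnaryExtensions.
Context {d : Order.disp_t} {P : porderType d} {D : set P}.
Implicit Type G : D -> P.

Lemma isotone_extension G : has_meets (range G) -> cond_iso G ->
  exists K, [/\ forall a : D, K (val a) = G a, isotone K &
                pextensive G -> extensive K].
Proof.
move=> meetG Giso.
have [//| |K [KE Kiso K_ge]] :=
  monotone_extension (fun x y : P => x <= y) D G _ _ meetG Giso.
  by move=> x y z; exact: le_trans.
exists K; split=> // Gext x; apply: K_ge => a xa.
exact: le_trans xa (Gext a).
Qed.

Lemma antitone_extension G :
  has_meets (range G) -> cond_ant G -> extendable G antitone.
Proof.
move=> meetG Gant.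
have [//| | |K [KE Kant _]] :=
  monotone_extension (fun x y : P => y <= x) D G _ _ meetG.
- by move=> x y z yx zy; exact: le_trans yx.
- by move=> a b; exact: Gant.
by exists K => // x y; exact: Kant.
Qed.

(** [K x] is the greatest element of [below x].  It is the meet [m] of those
    [G a] that bound [below x] from above, and the point is that [m] again lies
    in [below x]: if [m <= a], then [a], hence by the first clause also [G a],
    bounds [below x], and so [m <= G a]. *)
Lemma isotone_idempotent_extension G : has_meets (range G) ->
    cond_iso G -> cond_isoide G -> cond_isoide' G ->
  exists K, [/\ forall a : D, K (val a) = G a, isotone K, idempotent_fun K &
                pextensive G -> extensive K].
Proof.
move=> meetG Giso Gisoide Gisoide'.
pose stable z := forall a : D, z <= val a -> z <= G a.
pose below x := [set z | stable z /\
  forall a : D, x <= val a \/ x <= G a -> z <= G a].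
have maxP x : exists m, below x m /\ ubound (below x) m.
  have [|m [m_le m_ge]] :=
      meetG [set G a | a in [set a : D | ubound (below x) (G a)]].
    by move=> _ [a _ <-]; exists a.
  have m_ub : ubound (below x) m.
    by move=> z xz; apply: m_ge => _ [a + <-]; apply.
  exists m; do 2!split=> //.
  - move=> a ma; apply: m_le; exists a => //= z xz; case: (xz) => + _; apply.
    exact: le_trans (m_ub z xz) ma.
  - by move=> a xa; apply: m_le; exists a => //= z [_]; apply.
pose K x := projT1 (cid (maxP x)).
have K_stable x : stable (K x) by rewrite /K; case: cid => m [[]].
have K_le x (a : D) : x <= val a \/ x <= G a -> K x <= G a.
  by rewrite /K; case: cid => m /= [[_]] + _; apply.
have K_max x z : stable z ->
    (forall a : D, x <= val a \/ x <= G a -> z <= G a) -> z <= K x.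
  by move=> zs zx; rewrite /K; case: cid => m /= [_]; apply.
exists K; split.
- move=> c; apply/le_anti/andP; split; first by apply: (K_le); left.
  by apply: K_max => [a|a [/Giso|/Gisoide]//]; exact: Gisoide'.
- move=> x y xy; apply: K_max => // a ya; apply: K_le.
  by case: ya => /(le_trans xy); [left|right].
- move=> x /=; apply/le_anti/andP; split.
    by apply: K_max => // a xa; apply: (K_le); right; exact: K_le.
  by apply: K_max => // a [/K_stable|].
- move=> Gext x; apply: K_max => [a xa|a [xa|//]];
  exact: le_trans xa (Gext a).
Qed.

End UnaryExtensions.

Lemma pextensive_isoide_iso {d : Order.disp_t} {P : porderType d} {D : set P}
    (G : D -> P) : pextensive G -> cond_isoide G -> cond_iso G.
Proof. by move=> Ge Gi a b ab; apply/Gi/(le_trans ab). Qed.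

Lemma pextensive_isoide_isoide' {d : Order.disp_t} {P : porderType d}
    {D : set P} (G : D -> P) : pextensive G -> cond_isoide G -> cond_isoide' G.
Proof.
by move=> Ge Gi a b ab; apply/Gi/(le_trans (Ge a))/(le_trans ab).
Qed.

(** * Restrictions of unary operations *)

Section Restriction.
Context {d : Order.disp_t} {P : porderType d} {D : set P}.
Context {G : D -> P} {K : P -> P}.
Hypothesis KE : forall a : D, K (val a) = G a.

Lemma restrict_extensive : extensive K -> pextensive G.
Proof. by move=> Ke a; rewrite -KE. Qed.

Lemma restrict_contractive : contractive K -> pcontractive G.
Proof. by move=> Kc a; rewrite -KE. Qed.

Lemma restrict_ide : idempotent_fun K -> cond_ide G.
Proof. by move=> Ki a h; rewrite -KE /= -KE; apply: Ki. Qed.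

Lemma restrict_inv : involutive K -> cond_inv G.
Proof. by move=> Ki a h; rewrite -KE /= -KE Ki. Qed.

Lemma restrict_invb : involutive K -> cond_invb G.
Proof.
by move=> Ki a b; rewrite -!KE => /(inv_inj Ki); apply: val_inj.
Qed.

Lemma restrict_iso : isotone K -> cond_iso G.
Proof. by move=> Ki a b /Ki; rewrite !KE. Qed.

Lemma restrict_ant : antitone K -> cond_ant G.
Proof. by move=> Ki a b /Ki; rewrite !KE. Qed.

Lemma restrict_isoide : isotone K -> idempotent_fun K -> cond_isoide G.
Proof. by move=> Ki KK a b; rewrite -!KE => /Ki; rewrite [K (K _)]KK. Qed.

Lemma restrict_isoide' : isotone K -> idempotent_fun K -> cond_isoide' G.
Proof. by move=> Ki KK a b; rewrite -!KE => /Ki; rewrite [K (K _)]KK. Qed.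

End Restriction.

(** * Unary equivalences that are used in both orders *)

Section UnaryEquivalences.
Context {d : Order.disp_t} {P : porderType d} {D : set P}.
Implicit Type G : D -> P.

Lemma extendable_isotone_extensive G : has_meets (range G) ->
  extendable G (fun K => isotone K /\ extensive K) <->
  cond_iso G /\ pextensive G.
Proof.
move=> meetG; split=> [[K KE [Ki Ke]]|[Gi Ge]].
  by split; [exact: restrict_iso KE Ki|exact: restrict_extensive KE Ke].
have [K [KE Ki Ke]] := isotone_extension G meetG Gi.
by exists K => //; split=> //; apply: Ke.
Qed.

Lemma extendable_closure G : has_meets (range G) ->
  extendable G closure_op <-> cond_isoide G /\ pextensive G.
Proof.
move=> meetG; split=> [[K KE [Ke Ki KK]]|[Gi Ge]].
  by split; [exact: restrict_isoide KE Ki KK|exact: restrict_extensive KE Ke].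
have [K [KE Ki KK Ke]] := isotone_idempotent_extension G meetG
  (pextensive_isoide_iso G Ge Gi) Gi (pextensive_isoide_isoide' G Ge Gi).
by exists K => //; split=> //; apply: Ke.
Qed.

End UnaryEquivalences.

(** Passing to the dual order turns meets into joins, extensive into contractive
    and (isoide) into (isoide') by conversion; only isotonicity has to be
    restated, with its arguments exchanged. *)
Section DualEquivalences.
Context {d : Order.disp_t} {P : porderType d} {D : set P}.
Variable G : D -> P.
Hypothesis joinG : has_joins (range G).

Lemma isotone_dual (K : P -> P) : @isotone _ P^d K <-> isotone K.
Proof. by split=> Ki x y; apply: Ki. Qed.

Lemma extendable_isotone_contractive :
  extendable G (fun K => isotone K /\ contractive K) <->
  cond_iso G /\ pcontractive G.
Proof.
have [to from] := @extendable_isotone_extensive _ P^d D G joinG.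
split=> [[K KE [/isotone_dual Ki Kc]]|[Gi Gc]].
  have [|Gi Gc] := to; first by exists K.
  by split=> // a b; exact: Gi.
have [|K KE [/isotone_dual Ki Kc]] := from; last by exists K.
by split=> // a b; exact: Gi.
Qed.

Lemma extendable_interior :
  extendable G interior_op <-> cond_isoide' G /\ pcontractive G.
Proof.
have [to from] := @extendable_closure _ P^d D G joinG.
split=> [[K KE [Kc /isotone_dual Ki KK]]|[Gi Gc]].
  have [|Gi Gc] := to; first by exists K.
  by split=> // a b; exact: Gi.
have [|K KE [Kc /isotone_dual Ki KK]] := from; last by exists K.
by split=> // a b; exact: Gi.
Qed.

End DualEquivalences.

(** * Operations of several arguments *)

Section NAry.
Context {d : Order.disp_t} {P : porderType d} {n : nat}.
Implicit Types (x y : P ^ n) (i j : nat).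

Definition mixed_le i j x y :=
  [/\ forall h : 'I_n, (h < i)%N -> x h <= y h,
      forall h : 'I_n, (i <= h < n - j)%N -> x h = y h &
      forall h : 'I_n, (n - j <= h)%N -> y h <= x h].

Lemma mixed_le_refl i j x : mixed_le i j x x.
Proof. by split. Qed.

Lemma mixed_le_trans i j x y z :
  mixed_le i j x y -> mixed_le i j y z -> mixed_le i j x z.
Proof.
move=> [x1 x2 x3] [y1 y2 y3]; split=> h hh.
- exact: le_trans (x1 h hh) (y1 h hh).
- by rewrite x2 // y2.
- exact: le_trans (y3 h hh) (x3 h hh).
Qed.

Definition splice (k : nat) x y : P ^ n :=
  [ffun h : 'I_n => if (h < k)%N then y h else x h].

(** Componentwise conditions yield the joint one by replacing the components of
    [x] by those of [y] one at a time; conversely a change of one component is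
    a comparison for [mixed_le] because the bound on [i + j] keeps the three
    ranges of indices disjoint. *)
Lemma iso_first_ant_last_mono i j (F : P ^ n -> P) : (i + j <= n)%N ->
  iso_first_ant_last i j F <->
  forall x y, mixed_le i j x y -> F x <= F y.
Proof.
move=> hij; have ij : (i <= n - j)%N.
  by rewrite leq_subRL; [rewrite addnC|exact: leq_trans (leq_addl i j) hij].
split=> [[Fi Fa] x y [xy1 xy2 xy3]|Fm].
  have steps k : (k <= n)%N -> F x <= F (splice k x y).
    elim: k => [_|k IHk kn].
      by rewrite [splice _ _ _](_ : _ = x)//; apply/ffunP=> h; rewrite ffunE.
    apply: le_trans (IHk (ltnW kn)) _; pose k' := Ordinal kn.
    have -> : splice k x y = set_component (splice k x y) k' (x k').
      apply/ffunP=> h; rewrite !ffunE; case: eqP => // ->.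
      by rewrite /= ltnn.
    have -> : splice k.+1 x y = set_component (splice k x y) k' (y k').
      apply/ffunP=> h; rewrite !ffunE; case: eqP => [->|/eqP hk].
        by rewrite /= ltnSn.
      by rewrite ltnS leq_eqVlt -[(h == k :> nat)]/(h == k') (negPf hk).
    have [ki|ik] := ltnP k i; first by apply: (Fi k' ki); exact: xy1.
    have [kj|jk] := ltnP k (n - j); last by apply: (Fa k' jk); exact: xy3.
    by rewrite xy2 //= ik.
  rewrite (le_trans (steps n (leqnn n)))// [splice _ _ _](_ : _ = y)//.
  by apply/ffunP=> h; rewrite ffunE ltn_ord.
split=> h hh x a b ab; apply: Fm; split=> k; rewrite !ffunE;
    case: eqP => // -> hk.
- by move: hk; rewrite leqNgt hh.
- by move: (leq_trans (leq_trans hh ij) hk); rewrite ltnn.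
- by move: (leq_ltn_trans hh (leq_trans hk ij)); rewrite ltnn.
- by case/andP: hk => _; rewrite ltnNge hh.
Qed.

Lemma nary_extension i j (X : set (P ^ n)) (V : X -> P) :
    (i + j <= n)%N -> has_meets (range V) -> cond_ison i j V ->
  exists F : P ^ n -> P, [/\ forall a : X, F (val a) = V a,
    iso_first_ant_last i j F &
    forall x z, (forall a : X, mixed_le i j x (val a) -> z <= V a) -> z <= F x].
Proof.
move=> hij meetV Vison.
have [| | |F [FE Fm F_ge]] := monotone_extension (mixed_le i j) X V _ _ meetV.
- exact: mixed_le_refl.
- exact: mixed_le_trans.
- by move=> a b []; exact: Vison.
by exists F; split=> //; apply/iso_first_ant_last_mono.
Qed.

(** A lower bound [f] on [V] passes to the extension as soon as [f] depends
    isotonically on the first [i] components and on nothing else. *)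
Lemma nary_extension_ge i j (X : set (P ^ n)) (V : X -> P) (I : Type)
    (f : I -> P ^ n -> P) :
    (i + j <= n)%N -> has_meets (range V) -> cond_ison i j V ->
    (forall k x y, (forall h : 'I_n, (h < i)%N -> x h <= y h) ->
       f k x <= f k y) ->
    (forall k (a : X), f k (val a) <= V a) ->
  nextendable V (fun F => iso_first_ant_last i j F /\
                          forall k x, f k x <= F x).
Proof.
move=> hij meetV Vison fmono fV.
have [F [FE Fm F_ge]] := nary_extension i j X V hij meetV Vison.
exists F => //; split=> // k x; apply: F_ge => a [xa _ _].
exact: le_trans (fmono k _ _ xa) (fV k a).
Qed.

Lemma extendable_iso_first_ant_last i j (X : set (P ^ n)) (V : X -> P) :
    (i + j <= n)%N -> has_meets (range V) ->
  nextendable V (iso_first_ant_last i j) <-> cond_ison i j V.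
Proof.
move=> hij meetV; split=> [[F FE /(iso_first_ant_last_mono _ _ _ hij) Fm]|].
  by move=> a b ab1 ab2 ab3; rewrite -!FE; apply: Fm.
move=> Vison; have [F [FE Fm _]] := nary_extension i j X V hij meetV Vison.
by exists F.
Qed.

End NAry.

Lemma eval_term_mono {d : Order.disp_t} {L : latticeType d} {i : nat}
    (t : lattice_term i) (x y : 'I_i -> L) :
  (forall h, x h <= y h) -> eval_term t x <= eval_term t y.
Proof.
by move=> xy; elim: t => //= t IHt u IHu; [exact: leI2|exact: leU2].
Qed.

Lemma meets_of_complete {d : Order.disp_t} {P : porderType d} (A : set P) :
  complete_lattice P \/ has_meets A -> has_meets A.
Proof. by case=> // cP S _; case: (cP S). Qed.

Lemma joins_of_complete {d : Order.disp_t} {P : porderType d} (A : set P) :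
  complete_lattice P \/ has_joins A -> has_joins A.
Proof. by case=> // cP S _; case: (cP S). Qed.

Theorem lemma3p1 (d : Order.disp_t) :
  (forall (P : porderType d) (D : set P) (G : D -> P),
    (* A1e *) (extendable G extensive <-> pextensive G) /\
    (* A1c *) (extendable G contractive <-> pcontractive G) /\
    (* A2 *) (extendable G (@idempotent_fun P) <-> cond_ide G) /\
    (* A2e *) (extendable G (fun K => idempotent_fun K /\ extensive K)
                 <-> cond_ide G /\ pextensive G) /\
    (* A2c *) (extendable G (fun K => idempotent_fun K /\ contractive K)
                 <-> cond_ide G /\ pcontractive G) /\
    (* A3 *) (extendable G (@involutive P) <-> cond_inv G /\ cond_invb G) /\
    (complete_lattice P \/ has_meets (range G) ->
      (* B1 *) (extendable G isotone <-> cond_iso G) /\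
      (* B1e *) (extendable G (fun K => isotone K /\ extensive K)
                   <-> cond_iso G /\ pextensive G) /\
      (* B2 *) (extendable G (fun K => isotone K /\ idempotent_fun K)
                  <-> [/\ cond_iso G, cond_isoide G & cond_isoide' G]) /\
      (* B3 *) (extendable G closure_op <-> cond_isoide G /\ pextensive G) /\
      (* B5 *) (extendable G antitone <-> cond_ant G)) /\
    (complete_lattice P \/ has_joins (range G) ->
      (* B1c *) (extendable G (fun K => isotone K /\ contractive K)
                   <-> cond_iso G /\ pcontractive G) /\
      (* B4 *) (extendable G interior_op <-> cond_isoide' G /\ pcontractive G)))
  /\
  (forall (P : porderType d) (n i j : nat) (hn : (0 < n)%N)
      (hij : (i + j <= n)%N) (X : set (P ^ n)) (V : X -> P),
    complete_lattice P \/ has_meets (range V) ->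
    (* C1 *)
    (nextendable V (iso_first_ant_last i j) <-> cond_ison i j V) /\
    (* C2 *)
    ((0 < i)%N ->
      (cond_ison i j V -> (forall a : X, val a (Ordinal hn) <= V a) ->
        nextendable V (fun F => iso_first_ant_last i j F /\
                         forall x : P ^ n, x (Ordinal hn) <= F x)) /\
      (forall S : {set 'I_n}, (forall h : 'I_n, h \in S -> (h < i)%N) ->
        cond_ison i j V -> (forall (a : X) (h : 'I_n), h \in S -> val a h <= V a) ->
        nextendable V (fun F => iso_first_ant_last i j F /\
                         forall (x : P ^ n) (h : 'I_n), h \in S -> x h <= F x))))
  /\
  (* C3 *)
  (forall (L : latticeType d) (n i j : nat) (hn : (0 < n)%N)
      (hij : (i + j <= n)%N) (X : set (L ^ n)) (V : X -> L) (t : lattice_term i),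
    complete_lattice L \/ has_meets (range V) ->
    cond_ison i j V ->
    (forall a : X, eval_term t (first_components hij (val a)) <= V a) ->
    nextendable V (fun F => iso_first_ant_last i j F /\
      forall x : L ^ n, eval_term t (first_components hij x) <= F x)).
Proof.
split; [move=> P D G|split].
- split; [|split; [|split; [|split; [|split; [|split; [|split]]]]]].
  + split=> [[K KE]|Ge]; first exact: restrict_extensive.
    exists (id_extension G); first exact: id_extension_val.
    exact: id_extension_extensive.
  + split=> [[K KE]|Gc]; first exact: restrict_contractive.
    exists (id_extension G); first exact: id_extension_val.
    exact: id_extension_contractive.
  + split=> [[K KE]|Gi]; first exact: restrict_ide.
    exists (id_extension G); first exact: id_extension_val.
    exact: id_extension_idempotent.
  + split=> [[K KE [Ki Ke]]|[Gi Ge]].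
      by split; [exact: restrict_ide KE Ki|exact: restrict_extensive KE Ke].
    exists (id_extension G); first exact: id_extension_val.
    by split; [exact: id_extension_idempotent|exact: id_extension_extensive].
  + split=> [[K KE [Ki Kc]]|[Gi Gc]].
      by split; [exact: restrict_ide KE Ki|exact: restrict_contractive KE Kc].
    exists (id_extension G); first exact: id_extension_val.
    by split; [exact: id_extension_idempotent|exact: id_extension_contractive].
  + split=> [[K KE Ki]|[Ginv Ginvb]]; last exact: involutive_extension.
    by split; [exact: restrict_inv KE Ki|exact: restrict_invb KE Ki].
  + move=> /meets_of_complete meetG; split; [|split; [|split; [|split]]].
    * split=> [[K KE]|Gi]; first exact: restrict_iso.
      by have [K [KE Ki _]] := isotone_extension G meetG Gi; exists K.
    * exact: extendable_isotone_extensive.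
    * split=> [[K KE [Ki KK]]|[G1 G2 G3]].
        split; [exact: restrict_iso KE Ki|exact: restrict_isoide KE Ki KK|].
        exact: restrict_isoide' KE Ki KK.
      have [K [KE Ki KK _]] := isotone_idempotent_extension G meetG G1 G2 G3.
      by exists K.
    * exact: extendable_closure.
    * split=> [[K KE]|]; first exact: restrict_ant.
      exact: antitone_extension.
  + move=> /joins_of_complete joinG; split.
      exact: extendable_isotone_contractive.
    exact: extendable_interior.
- move=> P n i j hn hij X V /meets_of_complete meetV; split.
    exact: extendable_iso_first_ant_last.
  move=> i0; split=> [Vison Vge|S Si Vison Vge].
    have [||F FE [Fm Fge]] := nary_extension_ge i j X V unit
      (fun _ x => x (Ordinal hn)) hij meetV Vison.
    + by move=> _ x y; apply.
    + by [].
    by exists F => //; split=> // x; exact: (Fge tt).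
  have [||F FE [Fm Fge]] := nary_extension_ge i j X V {h | h \in S}
    (fun h x => x (val h)) hij meetV Vison.
  + by move=> h x y; apply; apply/Si/valP.
  + by move=> h a; apply/Vge/valP.
  by exists F => //; split=> // x h hS; exact: (Fge (exist _ h hS)).
- move=> L n i j hn hij X V t /meets_of_complete meetV Vison Vge.
  have [||F FE [Fm Fge]] := nary_extension_ge i j X V unit
    (fun _ x => eval_term t (first_components hij x)) hij meetV Vison.
  + move=> _ x y xy; apply: eval_term_mono => h.
    by apply: xy; rewrite /= ltn_ord.
  + by [].
  by exists F => //; split=> // x; exact: (Fge tt).
Qed.
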